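(* For every $n\ge 3$ and every nonempty $\mathcal{F}\subseteq\{M_1,S_1,D_1\}$, $$\mathrm{ex}_\circlearrowright(n,\mathcal{F})=\min_{F\in\mathcal{F}}\mathrm{ex}_\circlearrowright(n,F).$$
   Context: $\Omega_n=\{v_0,\dots,v_{n-1}\}$ is the vertex set of a regular $n$-gon with the clockwise cyclic ordering. We write $x_1<x_2<\dots<x_k<x_1$ to mean that $x_1,\dots,x_k$ are distinct and occur in this clockwise cyclic order. A convex geometric hypergraph (cgh) on $\Omega_n$ is a set $H$ of $3$-element subsets (edges, or triangles) of $\Omega_n$. A cgh $H$ contains a cgh $F$ if there is an injection from the vertex set of $F$ to the vertex set of $H$ preserving the cyclic ordering and mapping edges to edges; otherwise $H$ is $F$-free. For a set $\mathcal{F}$ of cghs, $\mathrm{ex}_\circlearrowright(n,\mathcal{F})$ is the maximum number of edges in a cgh on $\Omega_n$ containing no member of $\mathcal{F}$, and $\mathrm{ex}_\circlearrowright(n,F)=\mathrm{ex}_\circlearrowright(n,\{F\})$. The configurations are the following cghs with two edges: - $D_1$: $\{x_1,x_2,x_3\},\{x_1,x_3,x_4\}$ with $x_1<x_2<x_3<x_4<x_1$. - $S_1$: $\{x_1,x_2,x_3\},\{x_1,x_4,x_5\}$ with $x_1<x_2<x_3<x_4<x_5<x_1$. - $M_1$: $\{x_1,x_2,x_3\},\{x_4,x_5,x_6\}$ with $x_1<x_2<\dots<x_6<x_1$. *)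

(* Defs.v *)
From HB Require Import structures.
From mathcomp Require Import all_boot.
From mathcomp Require Import finmap.

Set Implicit Arguments.
Unset Strict Implicit.
Unset Printing Implicit Defensive.

(* The vertex v_i of the regular n-gon Omega_n is the element i of 'I_n, the
   vertices being numbered clockwise. *)
Record cgh (n : nat) := Cgh {
  edges : {set {set 'I_n}};
  edgesP : [forall e in edges, #|e| == 3]
}.

HB.instance Definition _ n := [isSub for @edges n].
HB.instance Definition _ n := [Finite of cgh n by <:].

(* clockwise [:: x_1; ...; x_k] is x_1 < x_2 < ... < x_k < x_1: some rotation
   of the sequence has strictly increasing indices. *)
Definition clockwise n (s : seq 'I_n) : bool :=
  has (fun i => sorted ltn (map val (rot i s))) (iota 0 (size s).+1).

(* A cyclic ordering is a ternary relation, so it suffices to preserve the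
   cyclic order of triples. *)
Definition cyclic_mono m n (f : {ffun 'I_m -> 'I_n}) : bool :=
  [forall x, forall y, forall z,
     clockwise [:: x; y; z] ==> clockwise [:: f x; f y; f z]].

Definition contains m n (H : cgh n) (F : cgh m) : bool :=
  [exists f : {ffun 'I_m -> 'I_n},
    [&& injectiveb f, cyclic_mono f
      & [forall e in edges F, f @: e \in edges H]]].

Definition some_cgh := {m : nat & cgh m}.
HB.instance Definition _ := Choice.on some_cgh.

Local Open Scope fset_scope.

Definition is_free n (H : cgh n) (FF : {fset some_cgh}) : bool :=
  all (fun F : some_cgh => ~~ contains H (tagged F)) FF.

Definition ex_family (n : nat) (FF : {fset some_cgh}) : nat :=
  \max_(H : cgh n | is_free H FF) #|edges H|.

Definition ex (n : nat) (F : some_cgh) : nat := ex_family n [fset F].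

(* The minimum of a nonempty sequence (0 on the empty one). *)
Definition seq_min (s : seq nat) : nat := foldr minn (head 0 s) s.

Lemma seq_min_in (s : seq nat) : s != [::] -> seq_min s \in s.
Proof.
case: s => // x s _; rewrite /seq_min [head _ _]/=.
have mem t : foldr minn x t \in x :: t.
  elim: t => [|y t IHt] /=; first by rewrite inE.
  rewrite /minn; case: ifP => _; first by rewrite !inE eqxx orbT.
  by move: IHt; rewrite !inE => /orP[->|->]; rewrite ?orbT.
by move: (mem (x :: s)); rewrite inE => /orP[/eqP->|//]; rewrite mem_head.
Qed.

Lemma seq_min_le (s : seq nat) (x : nat) : x \in s -> seq_min s <= x.
Proof.
rewrite /seq_min; move: (head 0 s) => d.
elim: s => // y s IHs; rewrite inE /= geq_min => /predU1P[->|/IHs ->].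
  by rewrite leqnn.
by rewrite orbT.
Qed.

(* The triangle {x_a, x_b, x_c} in Omega_m, with x_1 < ... < x_m < x_1 being
   the vertices of Omega_m starting at v_0 (so x_i is v_(i-1)). *)
Definition tri (m a b c : nat) : {set 'I_m} :=
  [set i : 'I_m | i.+1 \in [:: a; b; c]].

Lemma D1_subproof :
  [forall e in [set tri 4 1 2 3; tri 4 1 3 4], #|e| == 3].
Proof.
apply/forall_inP => e; rewrite !inE => /orP[] /eqP ->;
by rewrite -sum1dep_card big_mkcond !big_ord_recl big_ord0.
Qed.

Lemma S1_subproof :
  [forall e in [set tri 5 1 2 3; tri 5 1 4 5], #|e| == 3].
Proof.
apply/forall_inP => e; rewrite !inE => /orP[] /eqP ->;
by rewrite -sum1dep_card big_mkcond !big_ord_recl big_ord0.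
Qed.

Lemma M1_subproof :
  [forall e in [set tri 6 1 2 3; tri 6 4 5 6], #|e| == 3].
Proof.
apply/forall_inP => e; rewrite !inE => /orP[] /eqP ->;
by rewrite -sum1dep_card big_mkcond !big_ord_recl big_ord0.
Qed.

Definition D1 : some_cgh := Tagged cgh (Cgh D1_subproof).
Definition S1 : some_cgh := Tagged cgh (Cgh S1_subproof).
Definition M1 : some_cgh := Tagged cgh (Cgh M1_subproof).

(* Main.v *)
(** In a D1-free hypergraph all triangles on a given chord lie on one side of
    it.  Directing each chord so that its triangles lie on its right makes every
    edge a cyclic triple of a tournament, so the number of edges is at most that
    of the cyclic triples of a near-regular tournament.  The circular tournament
    attains this bound: its cyclic triples, the triangles around the centre of
    the n-gon, contain none of M1, S1, D1.

    In an S1-free hypergraph the chords with triangles on both sides form a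
    matching.  Deleting the triangles on the thinner side of each of them leaves
    a D1-free hypergraph, and with h = n./2 at most h * (h - 1) triangles are
    deleted.  Adding to the central triangles the triangles v_i, v_j, v_(i+h) with
    i < h and i < j < i + h attains this bound, still avoiding S1 and M1.  Thus ex D1 <= ex {M1, S1, D1} and ex S1 <= ex {M1, S1}, and the
    theorem follows since ex is antitone in the family. *)

Require Import Defs.
From mathcomp Require Import all_boot.
From mathcomp Require Import finmap.
From mathcomp Require Import zify.

Set Implicit Arguments.
Unset Strict Implicit.
Unset Printing Implicit Defensive.

(** * Tournaments and their transitive triples *)

Definition tournament (V : finType) (T : rel V) :=
  forall x y, x != y -> T x y = ~~ T y x.

Definition out (V : finType) (T : rel V) (x : V) : {set V} :=
  [set y | (y != x) && T x y].

Definition dominated (V : finType) (T : rel V) (x : V) : {set {set V}} :=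
  [set x |: p | p in [set p : {set V} | p \subset out T x & #|p| == 2]].

Definition transitive_triples (V : finType) (T : rel V) : {set {set V}} :=
  \bigcup_x dominated T x.

Lemma mem_dominated (V : finType) (T : rel V) (x : V) (e : {set V}) :
  (e \in dominated T x) =
  [&& #|e| == 3, x \in e & [forall y in e, (y != x) ==> T x y]].
Proof.
apply/imsetP/and3P => [[p] | [e3 xe /forall_inP dom]].
  rewrite inE => /andP[/subsetP sub /eqP p2] ->.
  have xNp : x \notin p.
    by apply/negP => /sub; rewrite inE eqxx.
  split; [by rewrite cardsU1 xNp p2 | exact: setU11 |].
  apply/forall_inP => y /setU1P[-> | /sub]; first by rewrite eqxx.
  by rewrite inE => /andP[-> ->].
exists (e :\ x); last by rewrite setD1K.
rewrite inE; apply/andP; split.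
  apply/subsetP => y /setD1P[yx ye]; rewrite inE yx /=.
  exact: (implyP (dom y ye)).
by move: (cardsD1 x e); rewrite xe (eqP e3) => -[->].
Qed.

Lemma card_dominated (V : finType) (T : rel V) (x : V) :
  #|dominated T x| = 'C(#|out T x|, 2).
Proof.
rewrite /dominated card_in_imset ?cards_draws // => p q.
have xN (s : {set V}) : s \subset out T x -> x \notin s.
  by move/subsetP => sub; apply/negP => /sub; rewrite inE eqxx.
rewrite !inE => /andP[/xN xp _] /andP[/xN xq _] e.
by rewrite -(setU1K xp) e setU1K.
Qed.

Lemma transitive_triplesP (V : finType) (T : rel V) (e : {set V}) :
  reflect (exists2 x, x \in e & [/\ #|e| = 3 & forall y, y \in e -> y != x -> T x y])
          (e \in transitive_triples T).
Proof.
apply: (iffP bigcupP) => [[x _] | [x xe [e3 dom]]].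
  rewrite mem_dominated => /and3P[/eqP e3 xe /forall_inP dom].
  by exists x => //; split=> // y /dom/implyP.
exists x => //; rewrite mem_dominated e3 xe /=.
by apply/forall_inP => y ye; apply/implyP; apply: dom.
Qed.

(** A triple has at most one source, so the families [dominated T x] are pairwise disjoint. *)
Lemma card_transitive_triples (V : finType) (T : rel V) :
  tournament T ->
  #|transitive_triples T| = \sum_x 'C(#|out T x|, 2).
Proof.
move=> tT; rewrite -sum1_card partition_disjoint_bigcup => [|x y xy].
  by apply: eq_bigr => x _; rewrite sum1_card card_dominated.
apply/pred0P => e /=; rewrite !mem_dominated; apply/negbTE/negP.
case/andP=> /and3P[_ xe /forall_inP domx] /and3P[_ ye /forall_inP domy].
move: (implyP (domx y ye)) (implyP (domy x xe)).
by rewrite xy eq_sym xy (tT _ _ xy) => /(_ isT)/negP + /(_ isT).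
Qed.

(** Adding the sum to its transpose counts, for every x, each y other than x exactly once. *)
Lemma sum_out (V : finType) (T : rel V) :
  tournament T -> 2 * \sum_x #|out T x| = #|V| * #|V|.-1.
Proof.
move=> tT.
have outE x : #|out T x| = \sum_y ((y != x) && T x y : nat).
  by rewrite -sum1dep_card big_mkcond; apply: eq_bigr => y _; case: ifP.
rewrite (eq_bigr _ (fun x _ => outE x)) mul2n -addnn {1}exchange_big -big_split /=.
transitivity (\sum_(x : V) #|V|.-1); last by rewrite sum_nat_const.
apply: eq_bigr => x _; rewrite -big_split /=.
rewrite -(cardC1 x) -sum1_card [RHS]big_mkcond /=.
apply: eq_bigr => y _; rewrite inE eq_sym; case: eqVneq => //= xy.
by rewrite (tT _ _ xy); case: (T x y).
Qed.

(* The tangent to the convex sequence 'C(d, 2) between m and m + 1. *)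
Lemma bin2_tangent (m d : nat) : m * d <= 'C(d, 2) + 'C(m.+1, 2).
Proof.
have bin2E k : 2 * 'C(k, 2) = k * k.-1 by rewrite -mul_bin_diag bin1.
have := bin2E d; have := bin2E m.+1; case: d => [|d] /=; first by lia.
by have [?|?] := leqP m d; nia.
Qed.

Lemma bin2_tangent_eq (m d : nat) :
  (d == m) || (d == m.+1) -> m * d = 'C(d, 2) + 'C(m.+1, 2).
Proof.
have bin2E k : 2 * 'C(k, 2) = k * k.-1 by rewrite -mul_bin_diag bin1.
have := bin2E d; have := bin2E m.+1.
by case: d => [|d] /= ? ? /orP[]/eqP ?; subst; nia.
Qed.

(** All tournaments on V have the same out-degree sum, and 'C(d, 2) is convex in d, so nearly equal
    out-degrees minimise the sum of the 'C(d, 2). *)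
Lemma regular_min_transitive (V : finType) (m : nat) (T0 T : rel V) :
  tournament T0 -> tournament T ->
  (forall x, (#|out T0 x| == m) || (#|out T0 x| == m.+1)) ->
  #|transitive_triples T0| <= #|transitive_triples T|.
Proof.
move=> tT0 tT reg; rewrite !card_transitive_triples //.
(* With this constant added, the side of [T0] lies on the tangent and that of [T] on or above it. *)
rewrite -(leq_add2r (\sum_(x : V) 'C(m.+1, 2))) -!big_split /=.
rewrite -(eq_bigr _ (fun x _ => bin2_tangent_eq (reg x))).
apply: (@leq_trans (\sum_x m * #|out T x|)); last first.
  by apply: leq_sum => x _; apply: bin2_tangent.
rewrite -!big_distrr /= leq_mul2l.
by have := sum_out tT; rewrite -(sum_out tT0); lia.
Qed.

(** * Cyclic order, triangles and containment in terms of indices *)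

Definition cyc (a b c : nat) : bool :=
  [|| a < b < c, b < c < a | c < a < b].

Lemma clockwise3 (n : nat) (x y z : 'I_n) : clockwise [:: x; y; z] = cyc x y z.
Proof. by rewrite /clockwise /cyc /=; lia. Qed.

Lemma card3_cyc (n : nat) (e : {set 'I_n}) : #|e| = 3 ->
  exists a b c : 'I_n, [/\ a < b, b < c & e = [set a; b; c]].
Proof.
move=> e3.
have [a [b [c [ea ab ac bc]]]] : exists a b c : 'I_n,
    [/\ e = [set a; b; c], a != b :> nat, a != c :> nat & b != c :> nat].
  have /card_gt0P[a ae] : 0 < #|e| by rewrite e3.
  have /eqP/cards2P[b [c [bc ebc]]] : #|e :\ a| = 2.
    by have := cardsD1 a e; rewrite ae e3 => -[].
  have aN : a \notin [set b; c] by rewrite -ebc setD11.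
  exists a, b, c; rewrite -setUA -ebc setD1K //; split=> //.
    by apply: contraNneq aN => /val_inj ->; rewrite set21.
  by apply: contraNneq aN => /val_inj ->; rewrite set22.
have sw12 x y z : [set x; y; z] = [set y; x; z] :> {set 'I_n}.
  by rewrite (setUC [set x]).
have sw23 x y z : [set x; y; z] = [set x; z; y] :> {set 'I_n}.
  by rewrite -!setUA (setUC [set y]).
have [ab1|ab1] := ltnP a b; have [ac1|ac1] := ltnP a c;
  have [bc1|bc1] := ltnP b c.
- by exists a, b, c.
- by exists a, c, b; split; [lia | lia | rewrite ea sw23].
- lia.
- by exists c, a, b; split; [lia | lia | rewrite ea sw23 sw12].
- by exists b, a, c; split; [lia | lia | rewrite ea sw12].
- lia.
- by exists b, c, a; split; [lia | lia | rewrite ea sw12 sw23].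
- by exists c, b, a; split; [lia | lia | rewrite ea sw12 sw23 sw12].
Qed.

Lemma set3_inj (n : nat) (a b c a' b' c' : 'I_n) :
  a < b < c -> a' < b' < c' -> [set a; b; c] = [set a'; b'; c'] ->
  [/\ a = a', b = b' & c = c'].
Proof.
move=> abc abc' /setP E.
have {}E (x : 'I_n) : [|| x == a :> nat, x == b :> nat | x == c :> nat] =
    [|| x == a' :> nat, x == b' :> nat | x == c' :> nat].
  by have := E x; rewrite !inE -!orbA.
move: (E a) (E b) (E c) (E a') (E b') (E c'); rewrite !eqxx !orbT /= => *.
by split; apply/val_inj => /=; lia.
Qed.

(** [P] is tested only on the increasing listing of a triangle, so membership becomes arithmetic on
    indices. *)
Definition triples (n : nat) (P : nat -> nat -> nat -> bool) : {set {set 'I_n}} :=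
  [set e | [exists a : 'I_n, exists b : 'I_n, exists c : 'I_n,
     [&& a < b < c, P a b c & e == [set a; b; c]]]].

Lemma triplesP (n : nat) (P : nat -> nat -> nat -> bool) (e : {set 'I_n}) :
  reflect (exists a b c : 'I_n, [/\ a < b < c, P a b c & e = [set a; b; c]])
          (e \in triples n P).
Proof.
rewrite inE; apply: (iffP existsP) => [[a /existsP[b /existsP[c]]] | [a [b [c]]]].
  by case/and3P=> abc Pabc /eqP ->; exists a, b, c.
case=> abc Pabc ->; exists a; apply/existsP; exists b; apply/existsP; exists c.
by rewrite abc Pabc eqxx.
Qed.

Lemma mem_triples (n : nat) (P : nat -> nat -> nat -> bool) (a b c : 'I_n) :
  a < b < c -> ([set a; b; c] \in triples n P) = P a b c.
Proof.
move=> abc; apply/triplesP/idP => [[a' [b' [c' [abc' + E]]]] | Pabc].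
  by case: (set3_inj abc abc' E) => -> -> ->.
by exists a, b, c.
Qed.

Lemma set3_rot (n : nat) (a b c : 'I_n) : [set a; b; c] = [set b; c; a].
Proof. by rewrite -setUA setUC. Qed.

Lemma mem_triples_cyc (n : nat) (P : nat -> nat -> nat -> bool) (a b c : 'I_n) :
  cyc a b c -> ([set a; b; c] \in triples n P) =
    [|| (a < b < c) && P a b c, (b < c < a) && P b c a | (c < a < b) && P c a b].
Proof.
case/or3P=> abc.
- by rewrite mem_triples //; lia.
- by rewrite set3_rot mem_triples //; lia.
- by rewrite set3_rot set3_rot mem_triples //; lia.
Qed.

Lemma set3_card (n : nat) (a b c : 'I_n) : cyc a b c -> #|[set a; b; c]| = 3.
Proof.
move=> abc; rewrite -setUA cardsU1 cards2 !inE -!(inj_eq val_inj) /=.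
by move: abc; rewrite /cyc; lia.
Qed.

Lemma triples_card3 (n : nat) P : [forall e in triples n P, #|e| == 3].
Proof.
apply/forall_inP => e /triplesP[a [b [c [abc _ ->]]]].
by rewrite set3_card // /cyc abc.
Qed.

Definition cgh_triples (n : nat) P : cgh n := Cgh (triples_card3 n P).

(** With at least three vertices, any two lie in a cyclic triple with a third one; since the image
    triple is cyclic, the two images differ, which gives injectivity. *)
Lemma containsP (m n : nat) (H : cgh n) (F : cgh m.+3) :
  reflect (exists x : nat -> 'I_n,
      (forall i j k, i < j -> j < k -> k < m.+3 -> cyc (x i) (x j) (x k)) /\
      (forall e, e \in edges F -> [set x i | i : 'I_m.+3 in e] \in edges H))
    (contains H F).
Proof.
apply: (iffP existsP) => [[f /and3P[_ mono /forall_inP sub]] | [x [mono sub]]].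
  exists (fun i => f (inord i)); split=> [i j k ij jk km | e /sub].
    have := forallP (forallP (forallP mono (inord i)) (inord j)) (inord k).
    rewrite !clockwise3 !inordK ?(ltn_trans jk) ?(ltn_trans ij) ?(ltn_trans jk) //.
    by move/implyP; apply; rewrite /cyc ij jk.
  have -> // : [set f (inord i) | i : 'I_m.+3 in e] = f @: e.
  by apply: eq_imset => i; rewrite inord_val.
have mono' (i j k : 'I_m.+3) : cyc i j k -> cyc (x i) (x j) (x k).
  case/or3P=> /andP[/mono h1 /h1 /(_ (ltn_ord _))]; rewrite /cyc; lia.
exists [ffun i : 'I_m.+3 => x i]; apply/and3P; split.
- apply/injectiveP => i j; rewrite !ffunE => /(congr1 val) /= xij.
  apply/eqP/negP => /negP ij.
  have [k [ki kj]] : exists k : 'I_m.+3, k != i /\ k != j.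
    have : 0 < #|~: [set i; j]| by have := cardsC [set i; j]; rewrite card_ord cards2; lia.
    by case/card_gt0P=> k; rewrite !inE negb_or => /andP[]; exists k.
  have : cyc i j k || cyc j i k.
    by move: ij ki kj; rewrite -!(inj_eq val_inj) /cyc /=; lia.
  by case/orP=> /mono'; rewrite xij /cyc; lia.
- do 3!apply/forallP => ?; apply/implyP; rewrite !clockwise3 !ffunE; exact: mono'.
- apply/forall_inP => e /sub.
  have -> // : [ffun i : 'I_m.+3 => x i] @: e = [set x i | i : 'I_m.+3 in e].
  by apply: eq_imset => i; rewrite ffunE.
Qed.

Lemma imset_tri (T : finType) (m a b c : nat) (x : nat -> T) :
  a < m -> b < m -> c < m ->
  [set x i | i : 'I_m in tri m a.+1 b.+1 c.+1] = [set x a; x b; x c].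
Proof.
move=> am bm cm.
have -> : tri m a.+1 b.+1 c.+1 = [set Ordinal am; Ordinal bm; Ordinal cm].
  by apply/setP => i; rewrite !inE !eqSS -!(inj_eq val_inj) orbA.
by rewrite !imsetU !imset_set1.
Qed.

(** The two cyclic triples seen from [a] already determine the cyclic order of all four vertices. *)
Lemma contains_D1P (n : nat) (H : cgh n) :
  reflect (exists a b c d : 'I_n, [/\ cyc a b c, cyc a c d,
      [set a; b; c] \in edges H & [set a; c; d] \in edges H])
    (contains H (tagged D1)).
Proof.
apply: (iffP (containsP _ _)) => [[x [mono sub]] | [a [b [c [d [abc acd e1 e2]]]]]].
  exists (x 0), (x 1), (x 2), (x 3); split; try exact: mono.
    by rewrite -(@imset_tri _ 4) //; apply: sub; rewrite !inE eqxx.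
  by rewrite -(@imset_tri _ 4) //; apply: sub; rewrite !inE eqxx orbT.
exists (nth a [:: a; b; c; d]); split=> [|e].
  by do 3!case=> [|[|[|[|?]]]] //=; move: abc acd; rewrite /cyc; lia.
by rewrite !inE => /orP[]/eqP->; rewrite imset_tri.
Qed.

Lemma contains_S1P (n : nat) (H : cgh n) :
  reflect (exists a b c d e : 'I_n, [/\ cyc a b c, cyc a c d, cyc a d e,
      [set a; b; c] \in edges H & [set a; d; e] \in edges H])
    (contains H (tagged S1)).
Proof.
apply: (iffP (containsP _ _)) => [[x [mono sub]] | [a [b [c [d [e [abc acd ade e1 e2]]]]]]].
  exists (x 0), (x 1), (x 2), (x 3), (x 4); split; try exact: mono.
    by rewrite -(@imset_tri _ 5) //; apply: sub; rewrite !inE eqxx.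
  by rewrite -(@imset_tri _ 5) //; apply: sub; rewrite !inE eqxx orbT.
exists (nth a [:: a; b; c; d; e]); split=> [|E].
  by do 3!case=> [|[|[|[|[|?]]]]] //=; move: abc acd ade; rewrite /cyc; lia.
by rewrite !inE => /orP[]/eqP->; rewrite imset_tri.
Qed.

Lemma contains_M1 (n : nat) (H : cgh n) : contains H (tagged M1) ->
  exists a b c d e f : 'I_n, [/\ cyc a b c, cyc a c d, cyc a d e, cyc a e f
    & [set a; b; c] \in edges H /\ [set d; e; f] \in edges H].
Proof.
case/containsP => x [mono sub].
exists (x 0), (x 1), (x 2), (x 3), (x 4), (x 5); split; try exact: mono; split.
  by rewrite -(@imset_tri _ 6) //; apply: sub; rewrite !inE eqxx.
by rewrite -(@imset_tri _ 6) //; apply: sub; rewrite !inE eqxx orbT.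
Qed.

(** * The circular tournament and the extremal constructions *)

(* v_i beats the n./2 vertices that follow it clockwise; for even n the
   diameters are oriented from the smaller to the larger index. *)
Definition circular (n : nat) : rel 'I_n :=
  fun x y => (x < y <= x + n./2) || (y + n./2 < x).

(** For a < b < c the last condition bounds the third arc, n - (c - a). Its strictness follows the
    orientation of diameters in [circular]: for even n, one side of each diameter is kept. *)
Definition central (n a b c : nat) : bool :=
  [&& b - a <= n./2, c - b <= n./2 & n./2 < c - a].

(** The bound on a makes the chords from a to a + n./2 pairwise disjoint; for odd n it excludes the
    one starting at n./2. *)
Definition near_central (n a b c : nat) : bool :=
  (c - a == n./2) && (a < n./2).

Definition central_cgh (n : nat) : cgh n := cgh_triples n (central n).

Definition wide_cgh (n : nat) : cgh n :=
  cgh_triples n (fun a b c => central n a b c || near_central n a b c).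

Lemma circular_tournament (n : nat) : tournament (@circular n).
Proof. by move=> x y; rewrite -(inj_eq val_inj) /circular /=; lia. Qed.

Lemma card_interval (n lo hi : nat) :
  #|[set y : 'I_n | lo <= y < hi]| = minn hi n - lo.
Proof.
rewrite -sum1dep_card big_mkcond /=.
elim: n => [|n IHn]; first by rewrite big_ord0 minn0.
by rewrite big_ord_recr /= IHn; case: ifP; lia.
Qed.

Lemma card_out_circular (n : nat) (x : 'I_n) :
  (#|out (@circular n) x| == n.-1./2) || (#|out (@circular n) x| == n.-1./2.+1).
Proof.
(* The second interval holds the out-neighbours reached after wrapping past v_0. *)
have -> : out (@circular n) x =
    [set y : 'I_n | x.+1 <= y < x + n./2.+1] :|: [set y : 'I_n | 0 <= y < x - n./2].
  apply/setP => y; rewrite !inE -(inj_eq val_inj) /circular /=.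
  by lia.
rewrite cardsU !card_interval (_ : _ :&: _ = set0) ?cards0.
  by have := ltn_ord x; lia.
by apply/setP => y; rewrite !inE; lia.
Qed.

Lemma edges_central (n : nat) :
  edges (central_cgh n) =
  [set e : {set 'I_n} | #|e| == 3] :\: transitive_triples (@circular n).
Proof.
apply/setP => e; rewrite in_setD andbC [X in X && _]inE /=.
have [/card3_cyc[a [b [c [ab bc ->]]]] | e3] := eqVneq #|e| 3; last first.
  apply/negbTE; apply: contraNN e3.
  by move=> te; exact: (forall_inP (triples_card3 n _) _ te).
rewrite mem_triples ?ab //=.
(* A central triple is the directed cycle a, b, c, so every candidate source is beaten by its
   predecessor. *)
apply/idP/negP => [cen /transitive_triplesP[x] | nT].
  case/setUP=> [/setUP[] | ] /set1P -> [_ dom].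
  - have := dom c; rewrite !inE eqxx orbT -(inj_eq val_inj) /circular /= => /(_ isT).
    by move: cen; rewrite /central; lia.
  - have := dom a; rewrite !inE eqxx -(inj_eq val_inj) /circular /= => /(_ isT).
    by move: cen; rewrite /central; lia.
  - have := dom b; rewrite !inE eqxx orbT -(inj_eq val_inj) /circular /= => /(_ isT).
    by move: cen; rewrite /central; lia.
apply/negPn/negP => ncen; apply: nT; apply/transitive_triplesP.
have abc3 : #|[set a; b; c]| = 3 by apply: set3_card; rewrite /cyc ab bc.
have [x xe dom] : exists2 x, x \in [set a; b; c] &
    [&& (a == x) || circular x a, (b == x) || circular x b & (c == x) || circular x c].
  (* The three ways to fail [central], namely c - a too small, b - a too large and c - b too large,
     give the sources a, b and c. *)
  have : [|| circular a b && circular a c, circular b a && circular b c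
          | circular c a && circular c b].
    by move: ncen; rewrite /central /circular; lia.
  case/or3P=> /andP[h1 h2]; [exists a | exists b | exists c];
    by rewrite ?inE ?eqxx ?h1 ?h2 ?orbT.
exists x => //; split=> // y ye yx.
case/and3P: dom => da db dc; case/setUP: ye => [/setUP[] | ] /set1P E.
- by rewrite -E (negPf yx) in da.
- by rewrite -E (negPf yx) in db.
- by rewrite -E (negPf yx) in dc.
Qed.

Lemma central_sub_wide (n : nat) : edges (central_cgh n) \subset edges (wide_cgh n).
Proof.
apply/subsetP => e /triplesP[a [b [c [abc P ->]]]].
by rewrite mem_triples // P.
Qed.

(** The two triangles traverse their common chord in opposite directions, whereas clockwise chords
    of central triangles all follow [circular]. *)
Lemma central_free_D1 (n : nat) : ~~ contains (central_cgh n) (tagged D1).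
Proof.
apply/negP => /contains_D1P[a [b [c [d [abc acd]]]]].
rewrite !mem_triples_cyc //; move: abc acd (ltn_ord a) (ltn_ord b) (ltn_ord c) (ltn_ord d).
by rewrite /cyc /central; lia.
Qed.

(** The arcs from c to a and from a to d have total length above n, but arcs of wide triangles have
    length at most n - n./2. Hence n is odd and both triangles are near-central, with a < n./2 and a
    = d + n./2, which is absurd. *)
Lemma wide_free_S1 (n : nat) : ~~ contains (wide_cgh n) (tagged S1).
Proof.
apply/negP => /contains_S1P[a [b [c [d [e [abc acd ade]]]]]].
rewrite !mem_triples_cyc //.
move: abc acd ade (ltn_ord a) (ltn_ord b) (ltn_ord c) (ltn_ord d) (ltn_ord e).
by rewrite /cyc /central /near_central; lia.
Qed.

(** The arcs from c to a and from f to d have total length at least n + 2, while two arcs of wide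
    triangles reach at most 2 * (n - n./2) <= n + 1. *)
Lemma wide_free_M1 (n : nat) : ~~ contains (wide_cgh n) (tagged M1).
Proof.
apply/negP => /contains_M1[a [b [c [d [e [f [abc acd ade aef []]]]]]]].
have def : cyc d e f by move: abc acd ade aef; rewrite /cyc; lia.
rewrite !mem_triples_cyc //.
move: abc acd ade aef (ltn_ord a) (ltn_ord b) (ltn_ord c) (ltn_ord d) (ltn_ord e) (ltn_ord f).
by rewrite /cyc /central /near_central; lia.
Qed.

Lemma card_wide (n : nat) :
  #|edges (central_cgh n)| + n./2 * n./2.-1 <= #|edges (wide_cgh n)|.
Proof.
set h := n./2.
have in1 (i : 'I_h) : i < n by have := ltn_ord i; rewrite /h; lia.
have in2 (i : 'I_h) (j : 'I_h.-1) : i + j.+1 < n.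
  by have := ltn_ord i; have := ltn_ord j; rewrite /h; lia.
have in3 (i : 'I_h) : i + h < n by have := ltn_ord i; rewrite /h; lia.
(* The middle vertex is at offset j + 1, with 1 <= j + 1 < h, from the first. *)
pose f (p : 'I_h * 'I_h.-1) : {set 'I_n} :=
  [set Ordinal (in1 p.1); Ordinal (in2 p.1 p.2); Ordinal (in3 p.1)].
have lt_f p : Ordinal (in1 p.1) < Ordinal (in2 p.1 p.2) < Ordinal (in3 p.1).
  by have := ltn_ord p.2; rewrite /=; lia.
have injf : injective f.
  move=> p q E; case: (set3_inj (lt_f p) (lt_f q) E).
  move=> /(congr1 val) /= e1 /(congr1 val) /= e2 _.
  by case: p q e1 e2 {E} => [p1 p2] [q1 q2] /= e1 e2; congr pair; apply: val_inj => /=; lia.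
have cardf : #|f @: setT| = h * h.-1.
  by rewrite card_imset // cardsT card_prod !card_ord.
(* Subtracting the size of an empty intersection turns the sum into the size of a union. *)
rewrite -cardf -[_ + _]subn0 -[0](@cards0 {set 'I_n}).
have <- : edges (central_cgh n) :&: f @: setT = set0.
  apply/setP => e; rewrite in_set0; apply/negP => /setIP[+ /imsetP[p _ E]].
  by rewrite {}E mem_triples ?lt_f //= /central -/h; lia.
rewrite -cardsU subset_leq_card // subUset central_sub_wide /=.
apply/subsetP => _ /imsetP[p _ ->]; rewrite mem_triples ?lt_f //=.
by rewrite /near_central -/h addKn eqxx ltn_ord orbT.
Qed.

(** * Sides of chords and the bound for D1-free hypergraphs *)

Definition side (n : nat) (H : cgh n) (a b : 'I_n) : {set 'I_n} :=
  [set c : 'I_n | cyc a b c && ([set a; b; c] \in edges H)].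

Definition two_sided (n : nat) (H : cgh n) (a b : 'I_n) : bool :=
  (side H a b != set0) && (side H b a != set0).

Lemma two_sidedC (n : nat) (H : cgh n) (a b : 'I_n) :
  two_sided H a b = two_sided H b a.
Proof. exact: andbC. Qed.

Lemma two_sided_neq (n : nat) (H : cgh n) (a b : 'I_n) :
  two_sided H a b -> a != b.
Proof.
case/andP=> /set0Pn[c]; rewrite inE => /andP[abc _] _.
by rewrite -(inj_eq val_inj) /=; move: abc; rewrite /cyc; lia.
Qed.

Lemma two_sided_contains_D1 (n : nat) (H : cgh n) (a b : 'I_n) :
  two_sided H a b -> contains H (tagged D1).
Proof.
case/andP=> /set0Pn[c] + /set0Pn[d]; rewrite !inE => /andP[abc ec] /andP[bad ed].
apply/contains_D1P; exists b, c, a, d; split=> //.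
  by move: abc; rewrite /cyc; lia.
by rewrite -set3_rot.
Qed.

(* Chords without triangles are directed from the smaller to the larger index. *)
Definition chord_direction (n : nat) (H : cgh n) : rel 'I_n :=
  fun a b => if a < b then side H b a == set0 else side H a b != set0.

Lemma chord_direction_tournament (n : nat) (H : cgh n) :
  tournament (chord_direction H).
Proof.
move=> a b; rewrite -(inj_eq val_inj) /chord_direction /=.
by case: ltngtP => //= _ _; rewrite negbK.
Qed.

(** The vertex c witnesses one side of the chord ab; a triangle on the other side would complete a
    D1. *)
Lemma edge_chord_direction (n : nat) (H : cgh n) (a b c : 'I_n) :
  ~~ contains H (tagged D1) -> cyc a b c -> [set a; b; c] \in edges H ->
  ~~ chord_direction H b a.
Proof.
move=> free abc e.
have ab : a != b by rewrite -(inj_eq val_inj) /=; move: abc; rewrite /cyc; lia.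
have sab : side H a b != set0 by apply/set0Pn; exists c; rewrite inE abc.
have : ~~ two_sided H a b by apply: contraNN free; apply: two_sided_contains_D1.
rewrite -(chord_direction_tournament H ab) /two_sided /chord_direction sab negbK => ->.
by case: ifP.
Qed.

Lemma card_D1_free (n : nat) (H : cgh n) :
  ~~ contains H (tagged D1) -> #|edges H| <= #|edges (central_cgh n)|.
Proof.
move=> free; pose T := chord_direction H.
have sub (U : rel 'I_n) :
    transitive_triples U \subset [set e : {set 'I_n} | #|e| == 3].
  by apply/subsetP => e /transitive_triplesP[x _ [e3 _]]; rewrite inE e3.
apply: (@leq_trans #|[set e : {set 'I_n} | #|e| == 3] :\: transitive_triples T|).
  apply/subset_leq_card/subsetP => e eH.
  have e3 : #|e| == 3 by have /forall_inP := edgesP H; apply.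
  rewrite in_setD andbC [X in X && _]inE e3 /=.
  apply/negP => /transitive_triplesP[x xe [_ dom]].
  have [a [b [c [ab bc E]]]] := card3_cyc (eqP e3).
  (* The clockwise predecessor y of x in the triangle is not beaten by x, so x is no source. *)
  suff [y [z [yxz E']]] : exists y z : 'I_n, cyc y x z /\ e = [set y; x; z].
    have yx : y != x.
      by rewrite -(inj_eq val_inj) /=; move: yxz; rewrite /cyc; lia.
    have := edge_chord_direction free yxz; rewrite -E' => /(_ eH)/negP; apply.
    by apply: dom => //; rewrite E' !inE eqxx.
  move: xe; rewrite E => /setUP[/setUP[] | ] /set1P ->.
  - by exists c, b; rewrite -set3_rot; split=> //; rewrite /cyc; lia.
  - by exists a, c; split=> //; rewrite /cyc; lia.
  - by exists b, a; rewrite set3_rot; split=> //; rewrite /cyc; lia.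
rewrite edges_central !cardsD !(setIidPr (sub _)) leq_sub2l //.
apply: (@regular_min_transitive _ n.-1./2).
- exact: circular_tournament.
- exact: chord_direction_tournament.
- exact: card_out_circular.
Qed.

(** * Two-sided chords and the bound for S1-free hypergraphs *)

(** If a, u, v are clockwise and both au and av are two-sided, their outer triangles {a, x, u} and
    {a, v, y} form an S1. *)
Lemma two_sided_matching (n : nat) (H : cgh n) (a b c : 'I_n) :
  ~~ contains H (tagged S1) -> two_sided H a b -> two_sided H a c -> b = c.
Proof.
move=> free.
have excl (u v : 'I_n) : two_sided H a u -> two_sided H a v -> ~~ cyc a u v.
  case/andP=> _ /set0Pn[x]; rewrite inE => /andP[uax ex].
  case/andP=> /set0Pn[y]; rewrite inE => /andP[avy ey] _.
  apply: contraNN free => auv; apply/contains_S1P.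
  exists a, x, u, v, y; split=> //; first by move: uax auv; rewrite /cyc; lia.
  by rewrite -set3_rot.
move=> tab tac; apply/val_inj => /=.
move: (two_sided_neq tab) (two_sided_neq tac) (excl _ _ tab tac) (excl _ _ tac tab).
by rewrite -!(inj_eq val_inj) /= /cyc; lia.
Qed.

Definition thin_side (n : nat) (H : cgh n) (a b : 'I_n) : {set 'I_n} :=
  if #|side H a b| <= #|side H b a| then side H a b else side H b a.

(** The two sides are disjoint and share the n - 2 vertices off the chord. *)
Lemma card_thin_side (n : nat) (H : cgh n) (a b : 'I_n) :
  two_sided H a b -> #|thin_side H a b| <= n./2.-1.
Proof.
move=> /two_sided_neq ab.
have : #|side H a b| + #|side H b a| <= n - 2.
  have <- : #|~: [set a; b]| = n - 2.
    by have := cardsC [set a; b]; rewrite cards2 ab card_ord; lia.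
  rewrite -[_ + _]subn0 -[0](@cards0 'I_n).
  have <- : side H a b :&: side H b a = set0.
    by apply/setP => c; rewrite !inE /cyc; lia.
  rewrite -cardsU subset_leq_card //; apply/subsetP => c.
  by rewrite !inE -!(inj_eq val_inj) /cyc /=; lia.
by rewrite /thin_side; case: ifP; lia.
Qed.

(** Listing each chord once, smaller index first, also fixes the side that [thin_side] picks in a
    tie. *)
Definition two_sided_chords (n : nat) (H : cgh n) : {set 'I_n * 'I_n} :=
  [set p : 'I_n * 'I_n | (p.1 < p.2) && two_sided H p.1 p.2].

(** By the matching property the lower and upper endpoints of these chords are all distinct, two per
    chord. *)
Lemma card_two_sided_chords (n : nat) (H : cgh n) :
  ~~ contains H (tagged S1) -> #|two_sided_chords H| <= n./2.
Proof.
move=> free; set D := two_sided_chords H.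
have inj1 : {in D &, injective fst}.
  move=> [a b] [a' c]; rewrite !inE /= => /andP[_ ab] /andP[_ ac] E; subst a'.
  by rewrite (two_sided_matching free ab ac).
have inj2 : {in D &, injective snd}.
  move=> [b a] [c a']; rewrite !inE /= => /andP[_ ab] /andP[_ ac] E; subst a'.
  by rewrite two_sidedC in ab; rewrite two_sidedC in ac;
     rewrite (two_sided_matching free ab ac).
have disj : fst @: D :&: snd @: D = set0.
  apply/setP => x; rewrite in_set0; apply/negP.
  case/setIP=> /imsetP[[a b] + ->] /imsetP[[c a'] + /= E]; subst a'.
  rewrite !inE /= => /andP[lt_ab ab] /andP[lt_ca]; rewrite two_sidedC => ac.
  by move: (two_sided_matching free ab ac) lt_ab lt_ca => ->; lia.
have := max_card (mem (fst @: D :|: snd @: D)).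
by rewrite cardsU disj cards0 !card_in_imset // card_ord subn0 addnn geq_half_double.
Qed.

Definition thin_triangles (n : nat) (H : cgh n) : {set {set 'I_n}} :=
  \bigcup_(p in two_sided_chords H)
    [set [set p.1; p.2; c] | c in thin_side H p.1 p.2].

Lemma card_thin_triangles (n : nat) (H : cgh n) :
  ~~ contains H (tagged S1) -> #|thin_triangles H| <= n./2 * n./2.-1.
Proof.
move=> free.
apply: (@leq_trans (\sum_(p in two_sided_chords H) n./2.-1)); last first.
  by rewrite sum_nat_const leq_mul2r card_two_sided_chords ?orbT.
rewrite /thin_triangles; elim/big_rec2: _ => [|p k A]; first by rewrite cards0.
rewrite inE => /andP[_ ts] IH.
apply: leq_trans (leq_card_setU _ _) _; apply: leq_add => //.
exact: leq_trans (leq_imset_card _ _) (card_thin_side ts).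
Qed.

Lemma pruned_card3 (n : nat) (H : cgh n) :
  [forall e in edges H :\: thin_triangles H, #|e| == 3].
Proof.
apply/forall_inP => e /setDP[eH _].
exact: (forall_inP (edgesP H) _ eH).
Qed.

(** The common chord of a D1 is two-sided in H, so one of the two triangles lies on its thin side
    and was deleted. *)
Lemma pruned_free_D1 (n : nat) (H : cgh n) :
  ~~ contains (Cgh (pruned_card3 H)) (tagged D1).
Proof.
apply/negP => /contains_D1P[a [b [c [d [abc acd /= /setDP[e1 t1] /setDP[e2 t2]]]]]].
have bs : b \in side H c a.
  by rewrite inE -set3_rot -set3_rot e1 andbT; move: abc; rewrite /cyc; lia.
have ds : d \in side H a c by rewrite inE acd.
have ts : two_sided H a c by apply/andP; split; apply/set0Pn; [exists d | exists b].
case: (ltnP a c) => ac.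
  have D : (a, c) \in two_sided_chords H by rewrite inE /= ac.
  have [E|E] : thin_side H a c = side H a c \/ thin_side H a c = side H c a.
    by rewrite /thin_side; case: ifP; [left | right].
    by case/negP: t2; apply/bigcupP; exists (a, c) => //=; rewrite E; apply: imset_f.
  case/negP: t1; apply/bigcupP; exists (a, c) => //=; rewrite E.
  by apply/imsetP; exists b => //; rewrite -setUA (setUC [set b]) setUA.
have {}ac : c < a by have := two_sided_neq ts; rewrite -(inj_eq val_inj) /=; lia.
have D : (c, a) \in two_sided_chords H by rewrite inE /= ac two_sidedC.
have [E|E] : thin_side H c a = side H a c \/ thin_side H c a = side H c a.
  by rewrite /thin_side; case: ifP; [right | left].
  case/negP: t2; apply/bigcupP; exists (c, a) => //=; rewrite E.
  by apply/imsetP; exists d => //; rewrite (setUC [set a]).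
case/negP: t1; apply/bigcupP; exists (c, a) => //=; rewrite E.
by apply/imsetP; exists b => //; rewrite set3_rot set3_rot.
Qed.

Lemma card_S1_free (n : nat) (H : cgh n) :
  ~~ contains H (tagged S1) ->
  #|edges H| <= #|edges (central_cgh n)| + n./2 * n./2.-1.
Proof.
move=> free.
apply: leq_trans (leq_add (card_D1_free (pruned_free_D1 H)) (card_thin_triangles free)).
apply: leq_trans (leq_card_setU _ _); apply/subset_leq_card/subsetP => e eH.
by rewrite in_setU in_setD eH andbT orNb.
Qed.

(** * Extremal numbers of families *)

Lemma contains_sub (m n : nat) (G H : cgh n) (F : cgh m) :
  edges G \subset edges H -> contains G F -> contains H F.
Proof.
move=> /subsetP sub /existsP[f /and3P[inj mono /forall_inP emb]].
apply/existsP; exists f; rewrite inj mono /=.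
by apply/forall_inP => e /emb/sub.
Qed.

Local Open Scope fset_scope.

Lemma is_freeP (n : nat) (H : cgh n) (FF : {fset some_cgh}) :
  reflect (forall F : some_cgh, F \in FF -> ~~ contains H (tagged F)) (is_free H FF).
Proof. exact: allP. Qed.

Lemma ex_family_sub (n : nat) (GG FF : {fset some_cgh}) :
  GG `<=` FF -> ex_family n FF <= ex_family n GG.
Proof.
move=> /fsubsetP sub; apply/bigmax_leqP => H /is_freeP free.
by apply: leq_bigmax_cond; apply/is_freeP => F /sub/free.
Qed.

Lemma ex_D1_le (n : nat) : ex n D1 <= ex_family n [fset M1; S1; D1].
Proof.
apply/bigmax_leqP => H /is_freeP/(_ D1); rewrite fset11 => /(_ isT)/card_D1_free le.
apply: leq_trans le _; apply: leq_bigmax_cond; apply/is_freeP => F.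
rewrite !inE => /orP[/orP[] | ] /eqP ->; last exact: central_free_D1.
  by apply: contraNN (wide_free_M1 n); apply/contains_sub/central_sub_wide.
by apply: contraNN (wide_free_S1 n); apply/contains_sub/central_sub_wide.
Qed.

Lemma ex_S1_le (n : nat) : ex n S1 <= ex_family n [fset M1; S1].
Proof.
apply/bigmax_leqP => H /is_freeP/(_ S1); rewrite fset11 => /(_ isT)/card_S1_free le.
apply: leq_trans le (leq_trans (card_wide n) _).
apply: leq_bigmax_cond; apply/is_freeP => F.
by rewrite !inE => /orP[] /eqP ->; [exact: wide_free_M1 | exact: wide_free_S1].
Qed.

Theorem mainTheorem3 (n : nat) (hn : 3 <= n) (FF : {fset some_cgh})
    (FF_neq0 : FF != fset0) (FF_sub : FF `<=` [fset M1; S1; D1]) :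
  ex_family n FF = seq_min [seq ex n F | F <- FF].
Proof.
have [F0 F0in] : exists F, F \in FF by apply/fset0Pn.
have mem (F : some_cgh) : F \in FF -> [|| F == M1, F == S1 | F == D1].
  by move=> /(fsubsetP FF_sub); rewrite !inE orbA.
apply/eqP; rewrite eqn_leq; apply/andP; split.
  have /mapP[F FFF ->] : seq_min [seq ex n F | F <- FF] \in [seq ex n F | F <- FF].
    apply: seq_min_in; apply/eqP => E.
    by have := map_f (ex n) F0in; rewrite E.
  by apply: ex_family_sub; rewrite fsub1set.
(* The witness is D1 if present, otherwise S1 if present; otherwise the family is just M1. *)
suff [F FFF le] : exists2 F, F \in FF & ex n F <= ex_family n FF.
  by apply: leq_trans le; apply: seq_min_le; apply: map_f.
have [inD1|D1N] := boolP (D1 \in FF).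
  exists D1 => //; exact: leq_trans (ex_D1_le n) (ex_family_sub n FF_sub).
have [inS1|S1N] := boolP (S1 \in FF).
  exists S1 => //; apply: leq_trans (ex_S1_le n) (ex_family_sub n _).
  apply/fsubsetP => F FFF; have := mem F FFF; rewrite !inE orbA.
  by case/orP=> // /eqP E; rewrite -E FFF in D1N.
exists F0 => //; apply: ex_family_sub; apply/fsubsetP => F FFF.
have eqM1 G : G \in FF -> G = M1.
  by move=> GF; case/or3P: (mem G GF) => /eqP E //; rewrite -E GF in S1N D1N.
by rewrite inE (eqM1 _ FFF) (eqM1 _ F0in).
Qed.
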